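(* There is a computable coloring $c:\mathcal{P}_{fin}(\mathbb{N})\rightarrow\{0,1\}$ such that for every $\Sigma^0_2$ set $\mathcal{S}\subseteq\mathcal{P}_{fin}(\mathbb{N})$ containing infinitely many pairwise disjoint elements, $c$ is not constant on $NU(\mathcal{S})$. In particular, no IP set which is $\Sigma^0_2$ is monochromatic for $c$.
   Context: $\mathcal{P}_{fin}(\mathbb{N})$ is the set of finite subsets of $\mathbb{N}$, identified with $\mathbb{N}$ via a fixed computable bijection. A set $\mathcal{S}\subseteq\mathcal{P}_{fin}(\mathbb{N})$ is $\Sigma^0_2$ if there is a computable relation $R$ with $\mathcal{S}=\{Z: \exists x\,\forall y\, R(x,y,Z)\}$. For $\mathcal{S}\subseteq\mathcal{P}_{fin}(\mathbb{N})$, $NU(\mathcal{S})$ denotes the set of non-empty sets which are unions of finitely many elements of $\mathcal{S}$. An IP set is a subset of $\mathcal{P}_{fin}(\mathbb{N})$ closed under finite unions and containing infinitely many pairwise disjoint elements. *)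

(* Defs.v *)
From Stdlib Require Import Arith List.
Import ListNotations.

Inductive rec_fn : Type :=
| RZero : rec_fn
| RSucc : rec_fn
| RProj : nat -> rec_fn
| RComp : rec_fn -> list rec_fn -> rec_fn
| RPrec : rec_fn -> rec_fn -> rec_fn
| RMu   : rec_fn -> rec_fn.

Inductive eval : rec_fn -> list nat -> nat -> Prop :=
| ev_zero : forall xs, eval RZero xs 0
| ev_succ : forall x xs, eval RSucc (x :: xs) (S x)
| ev_proj : forall i xs, eval (RProj i) xs (nth i xs 0)
| ev_comp : forall f gs xs ys y,
    evals gs xs ys -> eval f ys y -> eval (RComp f gs) xs y
| ev_prec0 : forall f g xs y, eval f xs y -> eval (RPrec f g) (0 :: xs) y
| ev_precS : forall f g n xs r y,
    eval (RPrec f g) (n :: xs) r -> eval g (n :: r :: xs) y ->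
    eval (RPrec f g) (S n :: xs) y
| ev_mu : forall f xs n,
    eval f (n :: xs) 0 ->
    (forall m, m < n -> exists k, eval f (m :: xs) (S k)) ->
    eval (RMu f) xs n
with evals : list rec_fn -> list nat -> list nat -> Prop :=
| evs_nil : forall xs, evals [] xs []
| evs_cons : forall g gs xs y ys,
    eval g xs y -> evals gs xs ys -> evals (g :: gs) xs (y :: ys).

Definition b2n (b : bool) : nat := if b then 1 else 0.

(* Finite subsets of N are coded by naturals via the standard computable
   bijection Z <-> sum_{i in Z} 2^i.  Membership: i \in Z <-> testbit Z i. *)
Definition fin_set := nat.
Definition fmem (i : nat) (Z : fin_set) : bool := Nat.testbit Z i.
Definition funion (Z1 Z2 : fin_set) : fin_set := Nat.lor Z1 Z2.
Definition fempty : fin_set := 0.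
Definition fdisjoint (Z1 Z2 : fin_set) : Prop := Nat.land Z1 Z2 = 0.

Definition computable_coloring (c : fin_set -> bool) : Prop :=
  exists e : rec_fn, forall Z, eval e [Z] (b2n (c Z)).

Definition computable_rel3 (R : nat -> nat -> fin_set -> bool) : Prop :=
  exists e : rec_fn, forall x y Z, eval e [x; y; Z] (b2n (R x y Z)).

Definition Sigma02 (S : fin_set -> Prop) : Prop :=
  exists R, computable_rel3 R /\
    forall Z, S Z <-> exists x, forall y, R x y Z = true.

Definition inf_pairwise_disjoint (S : fin_set -> Prop) : Prop :=
  exists f : nat -> fin_set,
    (forall n, S (f n)) /\
    (forall m n, m <> n -> f m <> f n) /\
    (forall m n, m <> n -> fdisjoint (f m) (f n)).

Definition big_union (l : list fin_set) : fin_set := fold_right funion fempty l.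

Definition NU (S : fin_set -> Prop) (Z : fin_set) : Prop :=
  Z <> fempty /\ exists l : list fin_set, (forall W, In W l -> S W) /\ Z = big_union l.

Definition IP_set (S : fin_set -> Prop) : Prop :=
  (forall Z1 Z2, S Z1 -> S Z2 -> S (funion Z1 Z2)) /\ inf_pairwise_disjoint S.

Definition constant_on (c : fin_set -> bool) (S : fin_set -> Prop) : Prop :=
  forall Z1 Z2, S Z1 -> S Z2 -> c Z1 = c Z2.

Definition monochromatic (c : fin_set -> bool) (S : fin_set -> Prop) : Prop :=
  exists b, forall Z, S Z -> c Z = b.

(* Main.v *)
Require Import Defs.
From Stdlib Require Import Arith List Lia Bool Classical ConstructiveEpsilon FinFun.
Import ListNotations.

(* Colour X by the parity of X & D_s, where s = max X and D_s is a finite set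
   computed from s.  If A and B are disjoint with max A < max B = s, then A u B
   and B have different colours as soon as |A & D_s| is odd.  An element of a
   Sigma^0_2 set S_e can be guessed in the limit: the least pair (x, Z) for
   which no y with R_e(x, y, Z) false has been found by stage s.  Each e gets
   e + 1 such guesses with distinct maxima, so that for all e <= s one can pick
   one guess per e with all the picked maxima distinct; the conditions
   "|Z & D_s| is odd" on the picked Z then form a triangular system over F_2,
   and D_s is its first solution.  For B in S_e far enough out, the guesses for
   e have stabilised to elements of S_e lying below B, hence disjoint from it.

   The relations R_e are enumerated by a universal relation: a computation is
   witnessed by a finite set of facts "program c maps a to y", each justified by
   others of the set.  No ordering of the facts is needed, because a
   justification only refers to subprograms or to a smaller recursion argument. *)

(** * Closure properties of recursive functions *)

(** Functions take the whole argument list, which avoids currying. The arity is fixed, since a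
    program for recursion copies its parameters by a number of projections known in advance. *)
Definition comp (k : nat) (f : list nat -> nat) : Prop :=
  exists e, forall xs, length xs = k -> eval e xs (f xs).

Lemma comp_ext k f g :
  (forall xs, f xs = g xs) -> comp k f -> comp k g.
Proof.
  intros E [e He]; exists e; intros xs Hx; rewrite <- E; auto.
Qed.

Lemma comp_nth k i : comp k (fun xs => nth i xs 0).
Proof. exists (RProj i); intros; constructor. Qed.

Lemma hd_iter_tl n xs : hd 0 (Nat.iter n (@tl nat) xs) = nth n xs 0.
Proof.
  revert xs; induction n as [|n IH]; intros xs.
  - now destruct xs.
  - rewrite Nat.iter_succ_r, IH; destruct xs; [now destruct n | reflexivity].
Qed.

(** Under a binder the new variable is [hd 0 ys] and the old arguments are [tl ys], so variables
    appear as heads of iterated tails; for a numeral [n] this form is convertible with them. *)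
Lemma comp_var n k : comp k (fun xs => hd 0 (Nat.iter n (@tl nat) xs)).
Proof.
  apply comp_ext with (fun xs => nth n xs 0); [|apply comp_nth].
  intros; symmetry; apply hd_iter_tl.
Qed.

Lemma comp_evals k (fs : list (list nat -> nat)) :
  Forall (comp k) fs ->
  exists gs, forall xs, length xs = k -> evals gs xs (map (fun f => f xs) fs).
Proof.
  induction 1 as [|f fs [e He] _ [gs IH]].
  - exists []; intros; constructor.
  - exists (e :: gs); intros; constructor; auto.
Qed.

Lemma comp_comp k m h fs :
  comp m h -> length fs = m -> Forall (comp k) fs ->
  comp k (fun xs => h (map (fun f => f xs) fs)).
Proof.
  intros [e He] Hl Hf; destruct (comp_evals _ _ Hf) as [gs Hg].
  exists (RComp e gs); intros xs Hx; econstructor; eauto.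
  apply He; now rewrite length_map.
Qed.

Lemma comp_S k a : comp k a -> comp k (fun xs => S (a xs)).
Proof.
  intros [e He]; exists (RComp RSucc [e]); intros xs Hx.
  econstructor; [repeat constructor; auto | constructor].
Qed.

Lemma comp_const k n : comp k (fun _ => n).
Proof.
  induction n as [|n IH]; [exists RZero; constructor | now apply (comp_S k (fun _ => n))].
Qed.

Definition projections (j k : nat) : list (list nat -> nat) :=
  map (fun i xs => nth i xs 0) (seq j k).

Lemma projections_comp j k n : Forall (comp n) (projections j k).
Proof.
  apply Forall_forall; intros f Hf; apply in_map_iff in Hf.
  destruct Hf as [i [<- _]]; apply comp_nth.
Qed.

Lemma projections_eval ys xs :
  map (fun f => f (ys ++ xs)) (projections (length ys) (length xs)) = xs.
Proof.
  unfold projections; rewrite map_map; revert ys.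
  induction xs as [|x xs IH]; intros ys; [reflexivity|]; simpl; f_equal.
  - now rewrite nth_middle.
  - specialize (IH (ys ++ [x])); rewrite length_app, Nat.add_1_r in IH.
    rewrite <- app_assoc in IH; exact IH.
Qed.

Lemma projections_length j k : length (projections j k) = k.
Proof. unfold projections; now rewrite length_map, length_seq. Qed.

(** [RPrec] recurses on its first argument and keeps the others as parameters, so [n xs] is put in
    front of a copy of [xs] made by projections. *)
Lemma comp_prec k b st n :
  comp k b ->
  comp (S (S k)) (fun ys => st (hd 0 ys) (hd 0 (tl ys)) (tl (tl ys))) ->
  comp k n ->
  comp k (fun xs => nat_rect (fun _ => nat) (b xs) (fun i r => st i r xs) (n xs)).
Proof.
  intros [eb Hb] [es Hs] [en Hn].
  destruct (comp_evals _ _ (projections_comp 0 k k)) as [gs Hg].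
  exists (RComp (RPrec eb es) (en :: gs)); intros xs Hx.
  apply ev_comp with (n xs :: xs).
  - constructor; [auto|].
    specialize (Hg xs Hx); subst k.
    generalize (projections_eval [] xs); simpl; intros E; now rewrite E in Hg.
  - induction (n xs) as [|i IH]; simpl.
    + constructor; auto.
    + econstructor; [apply IH|].
      apply (Hs (i :: _ :: xs)); simpl; lia.
Qed.

(** [RMu] stops at the value 0, hence the negation. *)
Lemma comp_mu k p m :
  comp (S k) (fun ys => b2n (negb (p (hd 0 ys) (tl ys)))) ->
  (forall xs, p (m xs) xs = true /\ forall i, i < m xs -> p i xs = false) ->
  comp k m.
Proof.
  intros [e He] Hm; exists (RMu e); intros xs Hx; destruct (Hm xs) as [H1 H2].
  constructor.
  - generalize (He (m xs :: xs)); simpl; rewrite H1; auto.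
  - intros i Hi; exists 0; generalize (He (i :: xs)); simpl; rewrite (H2 i Hi); auto.
Qed.

Lemma comp_app1 h k a :
  comp 1 (fun xs => h (hd 0 xs)) -> comp k a -> comp k (fun xs => h (a xs)).
Proof.
  intros Hh Ha; apply (comp_comp k 1 (fun xs => h (hd 0 xs)) [a]); auto.
Qed.

Lemma comp_app2 h k a b :
  comp 2 (fun xs => h (hd 0 xs) (hd 0 (tl xs))) ->
  comp k a -> comp k b -> comp k (fun xs => h (a xs) (b xs)).
Proof.
  intros Hh Ha Hb.
  apply (comp_comp k 2 (fun xs => h (hd 0 xs) (hd 0 (tl xs))) [a; b]); auto.
Qed.

Lemma comp_app3 h k a b c :
  comp 3 (fun xs => h (hd 0 xs) (hd 0 (tl xs)) (hd 0 (tl (tl xs)))) ->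
  comp k a -> comp k b -> comp k c -> comp k (fun xs => h (a xs) (b xs) (c xs)).
Proof.
  intros Hh Ha Hb Hc.
  apply (comp_comp k 3 (fun xs => h (hd 0 xs) (hd 0 (tl xs)) (hd 0 (tl (tl xs))))
           [a; b; c]); auto.
Qed.

Lemma comp_app4 h k a b c d :
  comp 4 (fun xs => h (hd 0 xs) (hd 0 (tl xs)) (hd 0 (tl (tl xs)))
                      (hd 0 (tl (tl (tl xs))))) ->
  comp k a -> comp k b -> comp k c -> comp k d ->
  comp k (fun xs => h (a xs) (b xs) (c xs) (d xs)).
Proof.
  intros Hh Ha Hb Hc Hd.
  apply (comp_comp k 4 (fun xs => h (hd 0 xs) (hd 0 (tl xs)) (hd 0 (tl (tl xs)))
                      (hd 0 (tl (tl (tl xs))))) [a; b; c; d]); auto.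
Qed.

(** The step of a recursion sees the counter and the previous result in front of the parameters; a
    function of one bound variable can be fed either of them. *)
Lemma comp_drop k h :
  comp (S k) (fun ys => h (hd 0 ys) (tl ys)) ->
  comp (S (S k)) (fun ys => h (hd 0 ys) (tl (tl ys))) /\
  comp (S (S k)) (fun ys => h (hd 0 (tl ys)) (tl (tl ys))).
Proof.
  intros Hh.
  assert (G : forall i, comp (S (S k)) (fun ys => h (nth i ys 0)
      (map (fun f => f ys) (projections 2 k)))).
  { intros i.
    apply (comp_comp _ _ _ ((fun xs => nth i xs 0) :: projections 2 k) Hh).
    - simpl; now rewrite projections_length.
    - constructor; [apply comp_nth | apply projections_comp]. }
  assert (E : forall x y xs, length xs = k ->
    map (fun f => f (x :: y :: xs)) (projections 2 k) = xs).
  { intros x y xs <-; exact (projections_eval [x; y] xs). }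
  split; [destruct (G 0) as [e He] | destruct (G 1) as [e He]];
    exists e; intros [|x [|y xs]] Hx; try discriminate;
    specialize (He _ Hx); simpl in He, Hx; rewrite E in He by lia; exact He.
Qed.

(** * Bounded quantifiers, bounded search, connectives and arithmetic *)

Definition bex (n : nat) (p : nat -> bool) : bool := existsb p (seq 0 n).
Definition ball (n : nat) (p : nat -> bool) : bool := forallb p (seq 0 n).

(* The least [i < n] satisfying [p]; the junk value is [n]. *)
Fixpoint bmin (n : nat) (p : nat -> bool) : nat :=
  match n with
  | 0 => 0
  | S i => let r := bmin i p in if p r then r else S i
  end.

Lemma bex_iff n p : bex n p = true <-> exists i, i < n /\ p i = true.
Proof.
  unfold bex; rewrite existsb_exists.
  split; intros [i [H1 H2]]; exists i; split; auto; apply in_seq in H1 || apply in_seq; lia.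
Qed.

Lemma ball_iff n p : ball n p = true <-> forall i, i < n -> p i = true.
Proof.
  unfold ball; rewrite forallb_forall.
  split; intros H i Hi; apply H; apply in_seq in Hi || apply in_seq; lia.
Qed.

Lemma bmin_spec n p :
  bmin n p <= n /\ (forall i, i < bmin n p -> p i = false) /\
  (bmin n p < n -> p (bmin n p) = true).
Proof.
  induction n as [|n [IH1 [IH2 IH3]]]; simpl.
  - repeat split; intros; lia.
  - destruct (p (bmin n p)) eqn:E; repeat split; auto; intros; try lia.
    assert (bmin n p = n).
    { destruct (Nat.lt_ge_cases (bmin n p) n) as [Hl|]; [|lia].
      apply IH3 in Hl; congruence. }
    destruct (Nat.eq_dec i n) as [->|]; [congruence | apply IH2; lia].
Qed.

Lemma bmin_eq n p m :
  m <= n -> (forall i, i < m -> p i = false) -> (m < n -> p m = true) -> bmin n p = m.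
Proof.
  intros H1 H2 H3; destruct (bmin_spec n p) as [G1 [G2 G3]].
  destruct (Nat.lt_trichotomy (bmin n p) m) as [L|[L|L]]; auto.
  - rewrite H2 in G3 by auto; discriminate G3; lia.
  - rewrite G2 in H3 by auto; discriminate H3; lia.
Qed.

(** Recursion over the truth value 0 or 1, with a step that ignores the previous result. The
    branches are first replaced by variables, so that they need not be shifted past the counter and
    that result. *)
Lemma comp_ifb k p a b :
  comp k (fun xs => b2n (p xs)) -> comp k a -> comp k b ->
  comp k (fun xs => if p xs then a xs else b xs).
Proof.
  intros Hp Ha Hb.
  apply comp_ext with (fun xs => nat_rect (fun _ => nat) (b xs) (fun _ _ => a xs) (b2n (p xs))).
  - intros xs; now destruct (p xs).
  - apply (comp_app3 (fun x y z => nat_rect (fun _ => nat) z (fun _ _ => y) x)); auto.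
    apply (comp_prec 3 (fun xs => hd 0 (tl (tl xs))) (fun _ _ xs => hd 0 (tl xs))
             (fun xs => hd 0 xs)).
    + exact (comp_var 2 3).
    + exact (comp_var 3 5).
    + exact (comp_var 0 3).
Qed.

Lemma comp_if k p q r :
  comp k (fun xs => b2n (p xs)) -> comp k (fun xs => b2n (q xs)) ->
  comp k (fun xs => b2n (r xs)) ->
  comp k (fun xs => b2n (if p xs then q xs else r xs)).
Proof.
  intros; apply comp_ext with (fun xs => if p xs then b2n (q xs) else b2n (r xs)).
  - intros xs; now destruct (p xs).
  - now apply comp_ifb.
Qed.

Lemma comp_true k : comp k (fun _ => b2n true).
Proof. apply comp_const. Qed.

Lemma comp_false k : comp k (fun _ => b2n false).
Proof. apply comp_const. Qed.

Lemma comp_and k p q :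
  comp k (fun xs => b2n (p xs)) -> comp k (fun xs => b2n (q xs)) ->
  comp k (fun xs => b2n (p xs && q xs)).
Proof. intros; apply comp_if; auto; apply comp_false. Qed.

Lemma comp_or k p q :
  comp k (fun xs => b2n (p xs)) -> comp k (fun xs => b2n (q xs)) ->
  comp k (fun xs => b2n (p xs || q xs)).
Proof. intros; apply comp_if; auto; apply comp_true. Qed.

Lemma comp_negb k p :
  comp k (fun xs => b2n (p xs)) -> comp k (fun xs => b2n (negb (p xs))).
Proof. intros; apply comp_if; auto; [apply comp_false | apply comp_true]. Qed.

Lemma comp_implb k p q :
  comp k (fun xs => b2n (p xs)) -> comp k (fun xs => b2n (q xs)) ->
  comp k (fun xs => b2n (implb (p xs) (q xs))).
Proof. intros; apply comp_if; auto; apply comp_true. Qed.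

Lemma comp_xorb k p q :
  comp k (fun xs => b2n (p xs)) -> comp k (fun xs => b2n (q xs)) ->
  comp k (fun xs => b2n (xorb (p xs) (q xs))).
Proof.
  intros; apply comp_ext with (fun xs => b2n (if p xs then negb (q xs) else q xs)).
  - intros xs; now destruct (p xs), (q xs).
  - apply comp_if; auto; now apply comp_negb.
Qed.

Lemma comp_pred k a : comp k a -> comp k (fun xs => pred (a xs)).
Proof.
  intros Ha.
  apply comp_ext with (fun xs => nat_rect (fun _ => nat) 0 (fun i _ => i) (a xs)).
  - intros xs; now destruct (a xs).
  - apply (comp_prec k (fun _ => 0) (fun i _ _ => i)); auto.
    + apply comp_const.
    + exact (comp_var 0 _).
Qed.

Lemma comp_add k a b : comp k a -> comp k b -> comp k (fun xs => a xs + b xs).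
Proof.
  intros Ha Hb.
  apply comp_ext with (fun xs => nat_rect (fun _ => nat) (b xs) (fun _ r => S r) (a xs)).
  - intros xs; induction (a xs); simpl; auto.
  - apply (comp_prec k b (fun _ r _ => S r)); auto.
    apply comp_S, (comp_var 1).
Qed.

Lemma comp_sub k a b : comp k a -> comp k b -> comp k (fun xs => a xs - b xs).
Proof.
  intros Ha Hb.
  apply comp_ext with (fun xs => nat_rect (fun _ => nat) (a xs) (fun _ r => pred r) (b xs)).
  - intros xs; induction (b xs); simpl; lia.
  - apply (comp_prec k a (fun _ r _ => pred r)); auto.
    apply comp_pred, (comp_var 1).
Qed.

Lemma comp_mul k a b : comp k a -> comp k b -> comp k (fun xs => a xs * b xs).
Proof.
  intros Ha Hb; apply (comp_app2 Nat.mul); auto.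
  apply comp_ext with (fun xs => nat_rect (fun _ => nat) 0
    (fun _ r => hd 0 (tl xs) + r) (hd 0 xs)).
  - intros xs; induction (hd 0 xs); simpl; auto.
  - apply (comp_prec 2 (fun _ => 0) (fun _ r xs => hd 0 (tl xs) + r) (hd 0)).
    + apply comp_const.
    + apply comp_add; [exact (comp_var 3 _) | exact (comp_var 1 _)].
    + exact (comp_var 0 _).
Qed.

Lemma comp_leb k a b : comp k a -> comp k b -> comp k (fun xs => b2n (a xs <=? b xs)).
Proof.
  intros; apply comp_ext with (fun xs => 1 - (a xs - b xs)).
  - intros xs; destruct (Nat.leb_spec (a xs) (b xs)); cbn [b2n]; lia.
  - repeat apply comp_sub; auto; apply comp_const.
Qed.

Lemma comp_ltb k a b : comp k a -> comp k b -> comp k (fun xs => b2n (a xs <? b xs)).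
Proof. intros; apply comp_leb; auto; now apply comp_S. Qed.

Lemma comp_eqb k a b : comp k a -> comp k b -> comp k (fun xs => b2n (a xs =? b xs)).
Proof.
  intros; apply comp_ext with (fun xs => b2n ((a xs <=? b xs) && (b xs <=? a xs))).
  - intros xs; f_equal.
    destruct (Nat.eqb_spec (a xs) (b xs)), (Nat.leb_spec (a xs) (b xs)),
      (Nat.leb_spec (b xs) (a xs)); simpl; auto; lia.
  - apply comp_and; now apply comp_leb.
Qed.

Lemma comp_max k a b : comp k a -> comp k b -> comp k (fun xs => Nat.max (a xs) (b xs)).
Proof.
  intros; apply comp_ext with (fun xs => a xs + (b xs - a xs)); [intros; lia|].
  apply comp_add; auto; now apply comp_sub.
Qed.

Lemma comp_bex k n p :
  comp k n -> comp (S k) (fun ys => b2n (p (hd 0 ys) (tl ys))) ->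
  comp k (fun xs => b2n (bex (n xs) (fun i => p i xs))).
Proof.
  (* The accumulator is a number; [1 <=? r] turns it back into a truth value. *)
  intros Hn Hp; apply comp_ext with (fun xs => nat_rect (fun _ => nat) 0
    (fun i r => b2n ((1 <=? r) || p i xs)) (n xs)).
  - intros xs; induction (n xs) as [|m IH]; [reflexivity|].
    unfold bex; rewrite seq_S, existsb_app; cbn [nat_rect existsb Nat.add]; rewrite IH, orb_false_r.
    fold (bex m (fun i => p i xs)); now destruct (bex m _).
  - apply (comp_prec k (fun _ => 0) (fun i r xs => b2n ((1 <=? r) || p i xs))); auto.
    + apply comp_const.
    + apply comp_or; [apply comp_leb; [apply comp_const | exact (comp_var 1 _)]|].
      apply (comp_drop k (fun i xs => b2n (p i xs)) Hp).
Qed.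

Lemma comp_ball k n p :
  comp k n -> comp (S k) (fun ys => b2n (p (hd 0 ys) (tl ys))) ->
  comp k (fun xs => b2n (ball (n xs) (fun i => p i xs))).
Proof.
  intros Hn Hp; apply comp_ext with (fun xs => b2n (negb (bex (n xs) (fun i => negb (p i xs))))).
  - intros xs; f_equal; unfold bex, ball; induction (seq 0 (n xs)); simpl; auto.
    rewrite negb_orb, negb_involutive; now f_equal.
  - apply comp_negb, (comp_bex k n (fun i xs => negb (p i xs))); auto.
    now apply comp_negb.
Qed.

Lemma comp_bmin k n p :
  comp k n -> comp (S k) (fun ys => b2n (p (hd 0 ys) (tl ys))) ->
  comp k (fun xs => bmin (n xs) (fun i => p i xs)).
Proof.
  intros Hn Hp; apply comp_ext with (fun xs => nat_rect (fun _ => nat) 0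
    (fun i r => if p r xs then r else S i) (n xs)).
  - intros xs; induction (n xs) as [|m IH]; simpl; auto; now rewrite IH.
  - apply (comp_prec k (fun _ => 0) (fun i r xs => if p r xs then r else S i)); auto.
    + apply comp_const.
    + apply comp_ifb.
      * apply (comp_drop k (fun i xs => b2n (p i xs)) Hp).
      * exact (comp_var 1 _).
      * apply comp_S; exact (comp_var 0 _).
Qed.

Ltac comp_variable :=
  first [ exact (comp_var 0 _) | exact (comp_var 1 _) | exact (comp_var 2 _)
        | exact (comp_var 3 _) | exact (comp_var 4 _) | exact (comp_var 5 _)
        | exact (comp_var 6 _) | exact (comp_var 7 _) ].

(* Hook, redefined once the coding functions are known to be recursive. *)
Ltac comp_extra := fail.

(** The closure lemmas for binders leave beta-redexes; contracting them first exposes the head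
    symbol on which the rule is chosen. *)
Ltac comp_step :=
  cbv beta;
  lazymatch goal with
  | |- comp _ (fun _ => ?c) => apply comp_const
  | |- comp _ (fun xs => hd 0 _) => comp_variable
  | |- comp _ (hd 0) => exact (comp_var 0 _)
  | |- comp _ (fun xs => S _) => apply comp_S
  | |- comp _ (fun xs => pred _) => apply comp_pred
  | |- comp _ (fun xs => _ + _) => apply comp_add
  | |- comp _ (fun xs => _ - _) => apply comp_sub
  | |- comp _ (fun xs => _ * _) => apply comp_mul
  | |- comp _ (fun xs => Nat.max _ _) => apply comp_max
  | |- comp _ (fun xs => if _ then _ else _) => apply comp_ifb
  | |- comp _ (fun xs => bmin _ _) => apply comp_bmin
  | |- comp _ (fun xs => b2n (bex _ _)) => apply comp_bex
  | |- comp _ (fun xs => b2n (ball _ _)) => apply comp_ball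
  | |- comp _ (fun xs => b2n (_ <? _)) => apply comp_ltb
  | |- comp _ (fun xs => b2n (_ <=? _)) => apply comp_leb
  | |- comp _ (fun xs => b2n (_ =? _)) => apply comp_eqb
  | |- comp _ (fun xs => b2n (_ && _)) => apply comp_and
  | |- comp _ (fun xs => b2n (_ || _)) => apply comp_or
  | |- comp _ (fun xs => b2n (negb _)) => apply comp_negb
  | |- comp _ (fun xs => b2n (xorb _ _)) => apply comp_xorb
  | |- comp _ (fun xs => b2n (implb _ _)) => apply comp_implb
  | |- comp _ (fun xs => b2n (if _ then _ else _)) => apply comp_if
  | _ => comp_extra
  end.

Ltac comp_auto := repeat comp_step.

(** The step function runs at arity [S (S k)], hence the hypothesis on [h] at every arity. *)
Lemma comp_iterate h b k n :
  (forall j a, comp j a -> comp j (fun xs => h (a xs))) ->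
  comp k n -> comp k b -> comp k (fun xs => Nat.iter (n xs) h (b xs)).
Proof.
  intros Hh Hn Hb.
  apply comp_ext with (fun xs => nat_rect (fun _ => nat) (b xs) (fun _ r => h r) (n xs)).
  - intros xs; induction (n xs); simpl; auto; now f_equal.
  - apply (comp_prec k b (fun _ r _ => h r)); auto; apply Hh; comp_auto.
Qed.

Lemma comp_odd k a : comp k a -> comp k (fun xs => b2n (Nat.odd (a xs))).
Proof.
  intros Ha; apply comp_ext with (fun xs => Nat.iter (a xs) (fun r => 1 - r) 0).
  - intros xs; induction (a xs) as [|n IH]; [reflexivity|].
    rewrite Nat.odd_succ, <- Nat.negb_odd; rewrite Nat.iter_succ, IH; now destruct (Nat.odd n).
  - apply (comp_iterate (fun r => 1 - r)); auto; intros; comp_auto; auto.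
Qed.

(** Half of [n], rounded down, is the number of odd numbers below [n]. *)
Lemma comp_div2 k a : comp k a -> comp k (fun xs => Nat.div2 (a xs)).
Proof.
  intros Ha; apply comp_ext with (fun xs => nat_rect (fun _ => nat) 0
    (fun i r => r + b2n (Nat.odd i)) (a xs)).
  - intros xs; induction (a xs) as [|n IH]; [reflexivity|]; simpl nat_rect; rewrite IH.
    generalize (Nat.div2_odd n) (Nat.div2_odd (S n)).
    rewrite Nat.odd_succ, <- Nat.negb_odd; destruct (Nat.odd n); simpl; lia.
  - apply (comp_prec k (fun _ => 0) (fun i r _ => r + b2n (Nat.odd i))); auto; comp_auto.
    apply comp_odd; comp_auto.
Qed.

Lemma comp_testbit k a b :
  comp k a -> comp k b -> comp k (fun xs => b2n (Nat.testbit (a xs) (b xs))).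
Proof.
  intros Ha Hb; apply comp_ext with (fun xs => b2n (Nat.odd (Nat.iter (b xs) Nat.div2 (a xs)))).
  - intros xs; f_equal; generalize (a xs); induction (b xs) as [|n IH]; intros c; auto.
    now rewrite Nat.iter_succ_r, IH.
  - apply comp_odd, comp_iterate; auto; apply comp_div2.
Qed.

Lemma comp_sqrt k a : comp k a -> comp k (fun xs => Nat.sqrt (a xs)).
Proof.
  apply (comp_app1 Nat.sqrt).
  (* The search exhausts its bound only for 0 and 1, which are their own roots, in agreement with
     the junk value of [bmin]. *)
  apply comp_ext with (fun xs => bmin (hd 0 xs) (fun r => hd 0 xs <? S r * S r)).
  - intros xs; generalize (hd 0 xs) as n; intros n.
    generalize (Nat.sqrt_spec n (Nat.le_0_l n)); intros [H1 H2].
    apply bmin_eq.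
    + apply Nat.sqrt_le_lin.
    + intros i Hi; apply Nat.ltb_ge; transitivity (Nat.sqrt n * Nat.sqrt n); auto.
      apply Nat.mul_le_mono; lia.
    + intros _; now apply Nat.ltb_lt.
  - comp_auto.
Qed.

Lemma comp_log2 k a : comp k a -> comp k (fun xs => Nat.log2 (a xs)).
Proof.
  apply (comp_app1 Nat.log2).
  apply comp_ext with (fun xs => bmin (hd 0 xs)
    (fun i => hd 0 xs <? Nat.iter (S i) (fun m => m + m) 1)).
  - intros xs; generalize (hd 0 xs) as n; intros n.
    assert (E : forall i, Nat.iter i (fun m => m + m) 1 = 2 ^ i)
      by (induction i; simpl; lia).
    destruct n as [|n]; [reflexivity|].
    destruct (Nat.log2_spec (S n)) as [H1 H2]; [lia|].
    apply bmin_eq.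
    + apply Nat.log2_le_lin; lia.
    + intros i Hi; rewrite E; apply Nat.ltb_ge.
      transitivity (2 ^ Nat.log2 (S n)); auto; apply Nat.pow_le_mono_r; lia.
    + intros _; rewrite E; now apply Nat.ltb_lt.
  - comp_auto.
    apply (comp_iterate (fun m => m + m)); intros; comp_auto; auto.
Qed.

(** * A universal recursively enumerable relation *)

(* The square coding is injective but not surjective; the projections are
   nevertheless total. *)
Definition pair (x y : nat) : nat := (x + y) * (x + y) + y.
Definition psnd (p : nat) : nat := p - Nat.sqrt p * Nat.sqrt p.
Definition pfst (p : nat) : nat := Nat.sqrt p - psnd p.

(** The code lies between consecutive squares, because [y <= 2 * (x + y)]. *)
Lemma sqrt_pair x y : Nat.sqrt (pair x y) = x + y.
Proof. apply Nat.sqrt_unique; unfold pair; lia. Qed.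

Lemma psnd_pair x y : psnd (pair x y) = y.
Proof. unfold psnd; rewrite sqrt_pair; unfold pair; lia. Qed.

Lemma pfst_pair x y : pfst (pair x y) = x.
Proof. unfold pfst; rewrite sqrt_pair, psnd_pair; lia. Qed.

Lemma pair_le_l x y : x <= pair x y.
Proof. unfold pair; nia. Qed.

Lemma pair_le_r x y : y <= pair x y.
Proof. unfold pair; lia. Qed.

Definition ccons (x l : nat) : nat := S (pair x l).
Definition chd (l : nat) : nat := pfst (pred l).
Definition ctl (l : nat) : nat := psnd (pred l).
Definition cnth (l i : nat) : nat := chd (Nat.iter i ctl l).
Definition clist (l : list nat) : nat := fold_right ccons 0 l.

Lemma chd_ccons x l : chd (ccons x l) = x.
Proof. apply pfst_pair. Qed.

Lemma ctl_ccons x l : ctl (ccons x l) = l.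
Proof. apply psnd_pair. Qed.

(** Past the end, the code 0 has head 0 and tail 0, which agrees with the default value of [nth]. *)
Lemma cnth_clist l i : cnth (clist l) i = nth i l 0.
Proof.
  unfold cnth; revert l; induction i as [|i IH]; intros l.
  - destruct l; [reflexivity | apply chd_ccons].
  - rewrite Nat.iter_succ_r; destruct l as [|x l]; simpl.
    + specialize (IH []); simpl in IH; now destruct i.
    + now rewrite ctl_ccons.
Qed.

(** * Codes of programs and closed sets of facts *)

Fixpoint code (f : rec_fn) : nat :=
  match f with
  | RZero => pair 0 0
  | RSucc => pair 1 0
  | RProj i => pair 2 i
  | RComp f gs => pair 3 (pair (code f) (clist (map code gs)))
  | RPrec f g => pair 4 (pair (code f) (code g))
  | RMu f => pair 5 (code f)
  end.

(* Evaluations of lists of programs are recorded as facts too, under the tag 6. *)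
Definition lcode (gs : list rec_fn) : nat := pair 6 (clist (map code gs)).

Definition fact (c a y : nat) : nat := pair c (pair a y).

Lemma le_fact c a y : y <= fact c a y.
Proof.
  unfold fact; transitivity (pair a y); apply pair_le_r.
Qed.

(* [T] is the bit set of a finite set of facts. *)
Definition justified (T c a y : nat) : bool :=
  let mem c a y := Nat.testbit T (fact c a y) in
  let b := psnd c in
  if pfst c =? 0 then y =? 0
  else if pfst c =? 1 then negb (a =? 0) && (y =? S (chd a))
  else if pfst c =? 2 then y =? cnth a b
  else if pfst c =? 3 then
    bex (S T) (fun ys => mem (pair 6 (psnd b)) a ys && mem (pfst b) ys y)
  else if pfst c =? 4 then
    negb (a =? 0) &&
    (if chd a =? 0 then mem (pfst b) (ctl a) y
     else bex (S T) (fun r =>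
       mem c (ccons (pred (chd a)) (ctl a)) r &&
       mem (psnd b) (ccons (pred (chd a)) (ccons r (ctl a))) y))
  else if pfst c =? 5 then
    mem b (ccons y a) 0 && ball y (fun m => bex (S T) (fun k => mem b (ccons m a) (S k)))
  else if b =? 0 then y =? 0
  else (y =? ccons (chd y) (ctl y)) &&
       (mem (chd b) a (chd y) && mem (pair 6 (ctl b)) a (ctl y)).

(** Bits of [T] at positions above [T] are 0, so the bounded test covers all members. *)
Definition closed (T : nat) : bool :=
  ball (S T) (fun q => implb (Nat.testbit T q)
    (justified T (pfst q) (pfst (psnd q)) (psnd (psnd q)))).

Lemma testbit_le T q : Nat.testbit T q = true -> q <= T.
Proof.
  intros H; destruct (Nat.le_gt_cases q T) as [|L]; auto.
  rewrite Nat.bits_above_log2 in H; [discriminate|].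
  apply Nat.le_lt_trans with T; auto; destruct T; [auto | apply Nat.log2_le_lin; lia].
Qed.

(** * Determinism of evaluation and soundness of closed sets *)

Lemma rec_fn_list_ind (P : rec_fn -> Prop) :
  P RZero -> P RSucc -> (forall i, P (RProj i)) ->
  (forall f gs, P f -> Forall P gs -> P (RComp f gs)) ->
  (forall f g, P f -> P g -> P (RPrec f g)) ->
  (forall f, P f -> P (RMu f)) ->
  forall f, P f.
Proof.
  intros H0 H1 H2 H3 H4 H5; fix IH 1; intros [| |i|f gs|f g|f].
  - exact H0.
  - exact H1.
  - apply H2.
  (* The generated principle has no hypothesis on the members of [gs]; the inner induction applies
     the fixpoint to each of them. *)
  - apply H3; [apply IH | induction gs; constructor; auto].
  - now apply H4.
  - now apply H5.
Qed.

(** Assuming the property only for the members of [gs] makes this usable inside an induction on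
    programs. *)
Lemma evals_det_of gs :
  Forall (fun g => forall xs y z, eval g xs y -> eval g xs z -> y = z) gs ->
  forall xs ys zs, evals gs xs ys -> evals gs xs zs -> ys = zs.
Proof.
  induction 1 as [|g gs Hg _ IH]; intros xs ys zs H1 H2; inversion H1; inversion H2; subst.
  - reflexivity.
  - f_equal; eauto.
Qed.

Lemma eval_det f : forall xs y z, eval f xs y -> eval f xs z -> y = z.
Proof.
  induction f as [| |i|f gs IHf IHgs|f g IHf IHg|f IHf] using rec_fn_list_ind;
    intros xs y z H1 H2.
  - inversion H1; inversion H2; congruence.
  - inversion H1; inversion H2; congruence.
  - inversion H1; inversion H2; congruence.
  - inversion H1; inversion H2; subst.
    assert (ys = ys0) by (eapply evals_det_of; eauto); subst; eauto.
  - assert (G : forall n xs y z, eval (RPrec f g) (n :: xs) y ->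
      eval (RPrec f g) (n :: xs) z -> y = z).
    { clear - IHf IHg; induction n as [|n IH]; intros xs y z H1 H2;
        inversion H1; inversion H2; subst; eauto.
      assert (r = r0) by eauto; subst; eauto. }
    destruct xs as [|n xs]; [inversion H1 | eauto].
  - inversion H1 as [| | | | | |f1 xs1 n1 A1 B1]; inversion H2 as [| | | | | |f2 xs2 n2 A2 B2]; subst.
    (* At the smaller of two different results, [f] would have both the value 0 and a positive
       value. *)
    destruct (Nat.lt_trichotomy y z) as [L|[L|L]]; auto.
    + destruct (B2 _ L) as [k Hk]; discriminate (IHf _ _ _ A1 Hk).
    + destruct (B1 _ L) as [k Hk]; discriminate (IHf _ _ _ A2 Hk).
Qed.

(** The first rewriting exposes the tag, which selects the branch of [justified]; the second decodes
    the operands of that branch. *)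
Ltac decode_in H :=
  unfold justified in H; rewrite ?pfst_pair, ?psnd_pair in H; cbn [Nat.eqb] in H;
  rewrite ?pfst_pair, ?psnd_pair in H.

Lemma closed_iff T :
  closed T = true <->
  forall q, Nat.testbit T q = true ->
    justified T (pfst q) (pfst (psnd q)) (psnd (psnd q)) = true.
Proof.
  unfold closed; rewrite ball_iff; split; intros H q Hq.
  - specialize (H q); rewrite Hq in H; apply H.
    apply testbit_le in Hq; lia.
  - destruct (Nat.testbit T q) eqn:E; [now apply H | reflexivity].
Qed.

Lemma closed_fact T c a y :
  closed T = true -> Nat.testbit T (fact c a y) = true -> justified T c a y = true.
Proof.
  intros H Hq; apply (proj1 (closed_iff T)) in Hq; auto.
  unfold fact in Hq; now rewrite ?psnd_pair, ?pfst_pair, ?psnd_pair in Hq.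
Qed.

(** That [y] codes a list is part of the conclusion. The coding is not surjective, so this relies on
    the test [y =? ccons (chd y) (ctl y)] in [justified]. *)
Lemma evals_sound_of T gs :
  closed T = true ->
  Forall (fun g => forall xs y,
    Nat.testbit T (fact (code g) (clist xs) y) = true -> eval g xs y) gs ->
  forall xs y, Nat.testbit T (fact (lcode gs) (clist xs) y) = true ->
  exists ys, y = clist ys /\ evals gs xs ys.
Proof.
  intros HT; induction 1 as [|g gs Hg _ IH]; intros xs y H.
  - apply (closed_fact _ _ _ _ HT) in H; decode_in H.
    exists []; apply Nat.eqb_eq in H; split; [auto | constructor].
  - apply (closed_fact _ _ _ _ HT) in H; unfold lcode in H; simpl map in H.
    change (clist (code g :: map code gs)) with (ccons (code g) (clist (map code gs))) in H.
    decode_in H; change (ccons (code g) (clist (map code gs)) =? 0) with false in H.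
    rewrite chd_ccons, ctl_ccons in H.
    apply andb_prop in H; destruct H as [E H]; apply andb_prop in H; destruct H as [H1 H2].
    apply Nat.eqb_eq in E.
    destruct (IH _ _ H2) as [ys [Ey Hys]].
    exists (chd y :: ys); split; [simpl; congruence | constructor; auto].
Qed.

Lemma eval_sound T :
  closed T = true ->
  forall f xs y, Nat.testbit T (fact (code f) (clist xs) y) = true -> eval f xs y.
Proof.
  intros HT; induction f as [| |i|f gs IHf IHgs|f g IHf IHg|f IHf] using rec_fn_list_ind;
    intros xs y H.
  - apply (closed_fact _ _ _ _ HT) in H; cbn [code] in H; decode_in H.
    apply Nat.eqb_eq in H; subst; constructor.
  - apply (closed_fact _ _ _ _ HT) in H; cbn [code] in H; decode_in H.
    destruct xs as [|x xs]; [discriminate|]; simpl in H.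
    rewrite chd_ccons in H; apply Nat.eqb_eq in H; subst; constructor.
  - apply (closed_fact _ _ _ _ HT) in H; cbn [code] in H; decode_in H.
    apply Nat.eqb_eq in H; subst; rewrite cnth_clist; constructor.
  - apply (closed_fact _ _ _ _ HT) in H; cbn [code] in H; decode_in H.
    apply bex_iff in H; destruct H as [a [_ H]].
    apply andb_prop in H; destruct H as [H1 H2].
    destruct (evals_sound_of T gs HT IHgs _ _ H1) as [ys [-> Hys]].
    econstructor; eauto.
  (* A fact about [RPrec] may rest on a fact about the same program, with a smaller recursion
     argument; an inner induction on that argument excludes circular justifications. *)
  - assert (G : forall n xs y,
      Nat.testbit T (fact (code (RPrec f g)) (clist (n :: xs)) y) = true ->
      eval (RPrec f g) (n :: xs) y).
    { clear xs y H; induction n as [|n IH]; intros xs y H;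
        apply (closed_fact _ _ _ _ HT) in H;
        cbn [code clist fold_right] in H; fold (clist xs) in H; decode_in H;
        rewrite chd_ccons, ctl_ccons in H; cbn [Nat.eqb Nat.pred negb andb] in H.
      - constructor; auto.
      - apply bex_iff in H; destruct H as [r [_ H]].
        apply andb_prop in H; destruct H as [H1 H2].
        apply ev_precS with r; [apply IH, H1 | apply IHg, H2]. }
    destruct xs as [|n xs]; auto.
    apply (closed_fact _ _ _ _ HT) in H; cbn [code] in H; decode_in H; discriminate.
  - apply (closed_fact _ _ _ _ HT) in H; cbn [code] in H; decode_in H.
    apply andb_prop in H; destruct H as [H1 H2].
    constructor; [apply IHf, H1|]; intros m Hm.
    apply (proj1 (ball_iff _ _) H2) in Hm; apply bex_iff in Hm.
    destruct Hm as [k [_ Hk]]; exists k; apply IHf, Hk.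
Qed.

(** * Completeness: evaluations occur in closed sets *)

Definition derivable (c a y : nat) : Prop :=
  exists T, closed T = true /\ Nat.testbit T (fact c a y) = true.

Definition subset (T U : nat) : Prop :=
  forall q, Nat.testbit T q = true -> Nat.testbit U q = true.

Lemma bex_mono T U p q :
  (forall i, p i = true -> q i = true) -> (forall i, q i = true -> i <= U) ->
  bex (S T) p = true -> bex (S U) q = true.
Proof.
  rewrite !bex_iff; intros H1 H2 [i [_ Hi]]; exists i; split; auto.
  apply H1, H2 in Hi; lia.
Qed.

(** The numbers sought in [justified] are bounded by values of facts of [T], so a search below [S T]
    misses none. *)
Lemma testbit_fact_le T c a y : Nat.testbit T (fact c a y) = true -> y <= T.
Proof. intros H; apply testbit_le in H; generalize (le_fact c a y); lia. Qed.

(** Membership in the set occurs only positively, and the bounds of the searches may be enlarged. *)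
Lemma justified_mono T U c a y :
  subset T U -> justified T c a y = true -> justified U c a y = true.
Proof.
  intros HTU; unfold justified.
  repeat match goal with |- (if ?b then _ else _) = true -> _ => destruct b end; auto;
    rewrite ?andb_true_iff.
  - apply bex_mono; intros i; rewrite !andb_true_iff; intros [H1 H2]; auto.
    now apply testbit_fact_le in H1.
  - intros [H1 H2]; split; auto; destruct (chd a =? 0); auto; revert H2.
    apply bex_mono; intros i; rewrite !andb_true_iff; intros [H2 H3]; auto.
    now apply testbit_fact_le in H2.
  - rewrite !ball_iff; intros [H1 H2]; split; auto.
    intros m Hm; generalize (H2 m Hm).
    apply bex_mono; auto; intros i Hi; apply testbit_fact_le in Hi; lia.
  - intros [H1 [H2 H3]]; auto.
Qed.

Lemma subset_lor_l T U : subset T (Nat.lor T U).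
Proof. intros q H; now rewrite Nat.lor_spec, H. Qed.

Lemma subset_lor_r T U : subset U (Nat.lor T U).
Proof. intros q H; now rewrite Nat.lor_spec, H, orb_true_r. Qed.

Lemma closed_lor T U : closed T = true -> closed U = true -> closed (Nat.lor T U) = true.
Proof.
  rewrite !closed_iff; intros HT HU q; rewrite Nat.lor_spec, orb_true_iff; intros [H|H].
  - now apply justified_mono with T; [apply subset_lor_l | apply HT].
  - now apply justified_mono with U; [apply subset_lor_r | apply HU].
Qed.

Lemma closed_setbit T c a y :
  closed T = true -> justified T c a y = true -> closed (Nat.setbit T (fact c a y)) = true.
Proof.
  intros HT HJ.
  assert (Hs : subset T (Nat.setbit T (fact c a y))).
  { intros q Hq; rewrite Nat.setbit_eqb, Hq; apply orb_true_r. }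
  rewrite closed_iff in *; intros q; rewrite Nat.setbit_eqb, orb_true_iff; intros [H|H].
  - apply Nat.eqb_eq in H; subst q; unfold fact at 2 3 4.
    rewrite !psnd_pair, !pfst_pair; eapply justified_mono; eauto.
  - eapply justified_mono; eauto.
Qed.

Lemma derivable_of T c a y : closed T = true -> justified T c a y = true -> derivable c a y.
Proof.
  intros HT HJ; exists (Nat.setbit T (fact c a y)); split; [now apply closed_setbit|].
  now rewrite Nat.setbit_eqb, Nat.eqb_refl.
Qed.

(** Minimisation has one premise for each smaller argument; closed sets for these premises are
    merged into a single one. *)
Lemma closed_common n (P : nat -> nat -> Prop) :
  (forall m T U, subset T U -> P m T -> P m U) ->
  (forall m, m < n -> exists T, closed T = true /\ P m T) ->
  exists T, closed T = true /\ forall m, m < n -> P m T.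
Proof.
  intros HP; induction n as [|n IH]; intros H.
  - exists 0; split; [reflexivity | intros; lia].
  - destruct IH as [T [HT HT']]; [intros; apply H; lia|].
    destruct (H n) as [U [HU HU']]; [lia|].
    exists (Nat.lor T U); split; [now apply closed_lor|].
    intros m Hm; destruct (Nat.eq_dec m n) as [->|].
    + eapply HP; [apply subset_lor_r | auto].
    + eapply HP; [apply subset_lor_l | apply HT'; lia].
Qed.

Lemma derivable_two c a y c' a' y' :
  derivable c a y -> derivable c' a' y' ->
  exists T, closed T = true /\
    Nat.testbit T (fact c a y) = true /\ Nat.testbit T (fact c' a' y') = true.
Proof.
  intros [T [HT H1]] [U [HU H2]]; exists (Nat.lor T U); split; [now apply closed_lor|].
  split; [now apply subset_lor_l | now apply subset_lor_r].
Qed.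

Ltac decode :=
  unfold justified; rewrite ?pfst_pair, ?psnd_pair; cbn [Nat.eqb];
  rewrite ?pfst_pair, ?psnd_pair.

Lemma evals_derivable_of gs :
  Forall (fun g => forall xs y, eval g xs y -> derivable (code g) (clist xs) y) gs ->
  forall xs ys, evals gs xs ys -> derivable (lcode gs) (clist xs) (clist ys).
Proof.
  induction 1 as [|g gs Hg _ IH]; intros xs ys H; inversion H; subst.
  - now apply derivable_of with 0.
  - match goal with H1 : eval g _ _, H2 : evals gs _ _ |- _ =>
      destruct (derivable_two _ _ _ _ _ _ (Hg _ _ H1) (IH _ _ H2)) as [T [HT [G1 G2]]] end.
    apply derivable_of with T; auto; unfold lcode; simpl map.
    change (clist (code g :: map code gs)) with (ccons (code g) (clist (map code gs))).
    change (clist (y :: ys0)) with (ccons y (clist ys0)).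
    decode; change (ccons (code g) (clist (map code gs)) =? 0) with false.
    cbv iota; rewrite !chd_ccons, !ctl_ccons, Nat.eqb_refl, G1; exact G2.
Qed.

Lemma eval_derivable f : forall xs y, eval f xs y -> derivable (code f) (clist xs) y.
Proof.
  induction f as [| |i|f gs IHf IHgs|f g IHf IHg|f IHf] using rec_fn_list_ind;
    intros xs y H.
  - inversion H; subst; now apply derivable_of with 0.
  - inversion H; subst; apply derivable_of with 0; auto; cbn [code]; decode.
    simpl clist; rewrite chd_ccons, Nat.eqb_refl; reflexivity.
  - inversion H; subst; apply derivable_of with 0; auto; cbn [code]; decode.
    rewrite cnth_clist; apply Nat.eqb_refl.
  - inversion H as [| | |f' gs' xs' ys y' Hgs Hf| | |]; subst.
    destruct (derivable_two _ _ _ _ _ _ (evals_derivable_of gs IHgs _ _ Hgs) (IHf _ _ Hf))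
      as [T [HT [G1 G2]]].
    apply derivable_of with T; auto; cbn [code]; decode.
    apply bex_iff; exists (clist ys); split; [apply testbit_fact_le in G1; lia|].
    unfold lcode in G1; now rewrite G1, G2.
  - assert (G : forall n xs y, eval (RPrec f g) (n :: xs) y ->
      derivable (code (RPrec f g)) (clist (n :: xs)) y).
    { clear xs y H; induction n as [|n IH]; intros xs y H; inversion H; subst.
      - match goal with H1 : eval f _ _ |- _ => destruct (IHf _ _ H1) as [T [HT G1]] end.
        apply derivable_of with T; auto; cbn [code clist fold_right]; fold (clist xs).
        decode; rewrite chd_ccons, ctl_ccons; exact G1.
      - match goal with H1 : eval (RPrec f g) _ _, H2 : eval g _ _ |- _ =>
          destruct (derivable_two _ _ _ _ _ _ (IH _ _ H1) (IHg _ _ H2)) as [T [HT [G1 G2]]] end.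
        apply derivable_of with T; auto; cbn [code clist fold_right]; fold (clist xs).
        decode; rewrite chd_ccons, ctl_ccons; cbn [Nat.eqb Nat.pred negb andb].
        apply bex_iff; exists r; split; [apply testbit_fact_le in G1; lia|].
        cbn [code clist fold_right] in G1, G2; fold (clist xs) in G1, G2.
        now rewrite G1, G2. }
    destruct xs as [|n xs]; [inversion H | auto].
  - inversion H as [| | | | | |f' xs' n' H0 H1]; subst.
    destruct (IHf _ _ H0) as [T [HT G]].
    destruct (closed_common y (fun m T => exists k,
      Nat.testbit T (fact (code f) (clist (m :: xs)) (S k)) = true)) as [U [HU G']].
    { intros m V W HVW [k Hk]; exists k; auto. }
    { intros m Hm; destruct (H1 m Hm) as [k Hk]; destruct (IHf _ _ Hk) as [V [HV HV']].
      exists V; eauto. }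
    apply derivable_of with (Nat.lor T U); [now apply closed_lor|]; cbn [code]; decode.
    apply andb_true_intro; split; [now apply subset_lor_l|].
    apply ball_iff; intros m Hm; destruct (G' m Hm) as [k Hk]; apply bex_iff.
    exists k; split; [|now apply subset_lor_r].
    apply (subset_lor_r T) in Hk; apply testbit_fact_le in Hk; lia.
Qed.

(** The fact sought says that program [e] maps the coded list of [x], [y], [Z] to 0, the code of
    [false]. The test makes sense for every number [e], whether or not it codes a total program. *)
Definition refutes (T e x Z : nat) : bool :=
  closed T &&
  bex (S T) (fun y => Nat.testbit T (fact e (ccons x (ccons y (ccons Z 0))) 0)).

(** Soundness, together with determinism against the total program for [R], gives one direction;
    completeness gives the other. *)
Lemma refutes_universal R :
  computable_rel3 R ->
  exists e, forall x Z, (exists T, refutes T e x Z = true) <-> (exists y, R x y Z = false).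
Proof.
  intros [f Hf]; exists (code f); intros x Z; split.
  - intros [T H]; apply andb_prop in H; destruct H as [HT H].
    apply bex_iff in H; destruct H as [y [_ H]]; exists y.
    apply (eval_sound T HT f [x; y; Z]) in H.
    generalize (eval_det _ _ _ _ H (Hf x y Z)); now destruct (R x y Z).
  - intros [y Hy]; generalize (Hf x y Z); rewrite Hy; intros H.
    apply eval_derivable in H; destruct H as [T [HT H]]; exists T.
    apply andb_true_intro; split; auto; apply bex_iff; exists y; split; [|exact H].
    (* The refuting [y] is a component of the code of a fact in [T], hence at most [T]. *)
    apply testbit_le in H; unfold fact in H; simpl b2n in H.
    assert (E : forall a b c d : nat, b <= pair c (pair (ccons a (ccons b d)) 0)).
    { clear; intros a b c d; unfold ccons.
      generalize (pair_le_r c (pair (S (pair a (S (pair b d)))) 0))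
        (pair_le_l (S (pair a (S (pair b d)))) 0)
        (pair_le_r a (S (pair b d))) (pair_le_l b d); lia. }
    generalize (E x y (code f) (ccons Z 0)); simpl clist in H; lia.
Qed.

(** * Recursiveness of the coding functions and of [refutes] *)

Lemma comp_pair k a b : comp k a -> comp k b -> comp k (fun xs => pair (a xs) (b xs)).
Proof. intros; unfold pair; comp_auto; auto. Qed.

Lemma comp_psnd k a : comp k a -> comp k (fun xs => psnd (a xs)).
Proof.
  intros; unfold psnd; apply comp_sub; auto; apply comp_mul; now apply comp_sqrt.
Qed.

Lemma comp_pfst k a : comp k a -> comp k (fun xs => pfst (a xs)).
Proof.
  intros; unfold pfst; apply comp_sub; [now apply comp_sqrt | now apply comp_psnd].
Qed.

Lemma comp_cnth k a b : comp k a -> comp k b -> comp k (fun xs => cnth (a xs) (b xs)).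
Proof.
  intros; unfold cnth, chd; apply comp_pfst, comp_pred, comp_iterate; auto.
  intros; now apply comp_psnd, comp_pred.
Qed.

Ltac comp_extra ::=
  lazymatch goal with
  | |- comp _ (fun xs => ccons _ _) => unfold ccons
  | |- comp _ (fun xs => chd _) => unfold chd
  | |- comp _ (fun xs => ctl _) => unfold ctl
  | |- comp _ (fun xs => fact _ _ _) => unfold fact
  | |- comp _ (fun xs => pair _ _) => apply comp_pair
  | |- comp _ (fun xs => pfst _) => apply comp_pfst
  | |- comp _ (fun xs => psnd _) => apply comp_psnd
  | |- comp _ (fun xs => cnth _ _) => apply comp_cnth
  | |- comp _ (fun xs => b2n (Nat.testbit _ _)) => apply comp_testbit
  end.

Lemma comp_justified k a b c d :
  comp k a -> comp k b -> comp k c -> comp k d ->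
  comp k (fun xs => b2n (justified (a xs) (b xs) (c xs) (d xs))).
Proof.
  apply (comp_app4 (fun a b c d => b2n (justified a b c d))).
  unfold justified; cbv zeta; comp_auto.
Qed.

Lemma comp_refutes k a b c d :
  comp k a -> comp k b -> comp k c -> comp k d ->
  comp k (fun xs => b2n (refutes (a xs) (b xs) (c xs) (d xs))).
Proof.
  apply (comp_app4 (fun a b c d => b2n (refutes a b c d))).
  unfold refutes, closed; comp_auto; apply comp_justified; comp_auto.
Qed.

(** * Parity of intersections *)

(** The inner product over F_2 of the characteristic vectors of [v] and [D], truncated to the first
    [n] coordinates. *)
Fixpoint parity_below (n v D : nat) : bool :=
  match n with
  | 0 => false
  | S i => xorb (parity_below i v D) (Nat.testbit v i && Nat.testbit D i)
  end.

Definition odd_meet (v D : nat) : bool := parity_below v v D.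

Lemma testbit_above v n : v < 2 ^ n -> forall i, n <= i -> Nat.testbit v i = false.
Proof.
  intros H i Hi; destruct (Nat.eq_dec v 0) as [->|Hv]; [apply Nat.bits_0|].
  apply Nat.bits_above_log2; apply Nat.log2_lt_pow2 in H; lia.
Qed.

Lemma parity_below_stable v D n m :
  v < 2 ^ n -> n <= m -> parity_below m v D = parity_below n v D.
Proof.
  intros Hv; induction 1 as [|m Hm IH]; [reflexivity|]; simpl.
  now rewrite (testbit_above v n Hv m Hm), IH, xorb_false_r.
Qed.

Lemma odd_meet_below v D n : v < 2 ^ n -> odd_meet v D = parity_below n v D.
Proof.
  intros Hv; unfold odd_meet.
  assert (v < 2 ^ v) by (apply Nat.pow_gt_lin_r; lia).
  destruct (Nat.le_ge_cases v n).
  - symmetry; now apply parity_below_stable.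
  - now apply parity_below_stable.
Qed.

(** The union of disjoint sets is the sum of their vectors over F_2, and the inner product is
    bilinear. *)
Lemma parity_below_lor n v w D :
  Nat.land v w = 0 ->
  parity_below n (Nat.lor v w) D = xorb (parity_below n v D) (parity_below n w D).
Proof.
  intros H; induction n as [|n IH]; [reflexivity|]; simpl; rewrite IH, Nat.lor_spec.
  assert (E : Nat.testbit v n && Nat.testbit w n = false)
    by now rewrite <- Nat.land_spec, H, Nat.bits_0.
  destruct (Nat.testbit v n), (Nat.testbit w n), (Nat.testbit D n); try discriminate E;
    now destruct (parity_below n v D), (parity_below n w D).
Qed.

Lemma odd_meet_lor v w D :
  Nat.land v w = 0 -> odd_meet (Nat.lor v w) D = xorb (odd_meet v D) (odd_meet w D).
Proof.
  intros H; set (n := Nat.lor v w + v + w).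
  assert (forall u, u <= n -> u < 2 ^ n).
  { intros u Hu; apply Nat.le_lt_trans with n; auto; apply Nat.pow_gt_lin_r; lia. }
  rewrite !(odd_meet_below _ _ n); [now apply parity_below_lor|..]; auto; apply H0; lia.
Qed.

Lemma parity_below_ext n v D D' :
  (forall i, i < n -> Nat.testbit D i = Nat.testbit D' i) ->
  parity_below n v D = parity_below n v D'.
Proof.
  induction n as [|n IH]; intros H; [reflexivity|]; simpl.
  rewrite IH, H; auto.
Qed.

Lemma bit_choice D n b :
  exists D', Nat.testbit D' n = b /\
    forall i, i < n -> Nat.testbit D' i = Nat.testbit D i.
Proof.
  destruct b; [exists (Nat.setbit D n) | exists (Nat.clearbit D n)]; split.
  - apply Nat.setbit_eq.
  - intros i Hi; apply Nat.setbit_neq; lia.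
  - apply Nat.clearbit_eq.
  - intros i Hi; apply Nat.clearbit_neq; lia.
Qed.

(* The maximum of [v] is [Nat.log2 v]; distinct maxima make the linear system over
   F_2 triangular, so it is solved bit by bit. *)
Lemma odd_meet_solvable (L : list nat) :
  (forall v, In v L -> v <> 0) ->
  (forall v w, In v L -> In w L -> Nat.log2 v = Nat.log2 w -> v = w) ->
  exists D, forall v, In v L -> odd_meet v D = true.
Proof.
  intros H0 Hinj.
  assert (G : forall n, exists D, forall v, In v L -> v < 2 ^ n -> odd_meet v D = true).
  { induction n as [|n [D HD]].
    - exists 0; intros v Hv Hlt; apply H0 in Hv; simpl in Hlt; lia.
    - destruct (in_dec Nat.eq_dec n (map Nat.log2 L)) as [Hn|Hn].
      + apply in_map_iff in Hn; destruct Hn as [w [Hw HwL]].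
        (* The set [w] has maximum [n], so setting bit [n] opposite to its parity so far makes the
           parity odd; sets with smaller maximum do not see this bit. *)
        destruct (bit_choice D n (negb (parity_below n w D))) as [D' [E1 E2]].
        exists D'; intros v Hv Hlt.
        destruct (Nat.lt_ge_cases v (2 ^ n)) as [Hl|Hg].
        * rewrite (odd_meet_below _ _ n), (parity_below_ext _ _ _ D) by auto.
          rewrite <- odd_meet_below by auto; auto.
        * assert (Nat.log2 v = n) by (apply Nat.log2_unique; lia).
          assert (v = w) by (apply Hinj; congruence); subst w.
          rewrite (odd_meet_below _ _ (S n)) by auto; simpl.
          rewrite E1, (parity_below_ext n v D' D) by auto.
          rewrite <- Hw at 2; rewrite Nat.bit_log2 by auto.
          now destruct (parity_below n v D).
      + exists D; intros v Hv Hlt; apply HD; auto.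
        destruct (Nat.lt_ge_cases v (2 ^ n)) as [Hl|Hg]; auto.
        destruct Hn; apply in_map_iff; exists v; split; auto.
        apply Nat.log2_unique; lia. }
  destruct (G (list_max L)) as [D HD]; exists D; intros v Hv; apply HD; auto.
  assert (v <= list_max L).
  { generalize (proj1 (list_max_le L (list_max L)) (Nat.le_refl _)).
    rewrite Forall_forall; auto. }
  apply Nat.le_lt_trans with (list_max L); auto; apply Nat.pow_gt_lin_r; lia.
Qed.

(** Pigeonhole: the [n + 1] values [F n j] with [j <= n] have different logarithms, and the [n]
    values already picked block at most [n] of these. *)
Lemma distinct_selection (F : nat -> nat -> nat) :
  (forall e i j, Nat.log2 (F e i) = Nat.log2 (F e j) -> i = j) ->
  forall n, exists L, length L = n /\
    (forall v, In v L -> exists e j, v = F e j) /\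
    (forall v w, In v L -> In w L -> Nat.log2 v = Nat.log2 w -> v = w) /\
    (forall e, e < n -> exists j, j <= e /\ In (F e j) L).
Proof.
  intros HF; induction n as [|n [L [Hlen [HL [Hinj Hsel]]]]].
  - exists []; repeat split; simpl; intros; try contradiction; lia.
  - assert (G : exists j, j <= n /\ ~ In (Nat.log2 (F n j)) (map Nat.log2 L)).
    { apply NNPP; intros N.
      assert (C : length (map (fun j => Nat.log2 (F n j)) (seq 0 (S n))) <=
                  length (map Nat.log2 L)).
      { apply NoDup_incl_length.
        - apply FinFun.Injective_map_NoDup; [|apply seq_NoDup].
          intros i j; apply HF.
        - intros m Hm; apply in_map_iff in Hm; destruct Hm as [j [<- Hj]].
          apply in_seq in Hj; apply NNPP; intros Hm; apply N; exists j; split; [lia | auto]. }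
      rewrite !length_map, length_seq in C; lia. }
    destruct G as [j [Hj Hnew]]; exists (F n j :: L); split; [simpl; lia|].
    assert (Hnew' : forall v, In v L -> Nat.log2 v <> Nat.log2 (F n j)).
    { intros v Hv E; apply Hnew; rewrite <- E; now apply in_map. }
    split; [|split].
    + intros v [<-|Hv]; eauto.
    + intros v w [<-|Hv] [<-|Hw] E; auto; [symmetry in E|]; now apply Hnew' in E.
    + intros e He; destruct (Nat.eq_dec e n) as [->|].
      * exists j; simpl; auto.
      * destruct (Hsel e) as [i [Hi HiL]]; [lia|]; exists i; simpl; auto.
Qed.

(** * The coloring *)

(** The number [p] stands for a pair of a witness and a set; it dies once some [T <= s] refutes
    it. *)
Definition alive (s e p : nat) : bool :=
  negb (bex (S s) (fun T => refutes T e (pfst p) (psnd p))).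

(* When no suitable pair is alive, the value is junk, but the lower bound
   [2 * z + 1], which forces [Nat.log2] to increase, always holds. *)
Definition next (s e z : nat) : nat :=
  Nat.max (psnd (bmin (S s) (fun p => (S (2 * z) <=? psnd p) && alive s e p))) (S (2 * z)).

(** The starting value 0 is not a guess itself: at least one step is made, so every guess is a
    non-empty set. *)
Definition candidate (s e j : nat) : nat := Nat.iter (S j) (next s e) 0.

(** Asking for some [j <= e], instead of fixing the selected guesses, keeps the test recursive
    without computing the selection. *)
Definition good (s D : nat) : bool :=
  ball (S s) (fun e => bex (S e) (fun j => odd_meet (candidate s e j) D)).

Lemma candidate_grows s e i : 2 * candidate s e i < candidate s e (S i).
Proof.
  unfold candidate; rewrite (Nat.iter_succ (S i)).
  set (z := Nat.iter (S i) _ _); unfold next; lia.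
Qed.

Lemma candidate_nonzero s e i : candidate s e i <> 0.
Proof. unfold candidate; rewrite Nat.iter_succ; unfold next; lia. Qed.

Lemma log2_candidate_lt s e i j :
  i < j -> Nat.log2 (candidate s e i) < Nat.log2 (candidate s e j).
Proof.
  assert (G : forall i, Nat.log2 (candidate s e i) < Nat.log2 (candidate s e (S i))).
  { clear; intros i; generalize (candidate_grows s e i) (candidate_nonzero s e i); intros H H0.
    apply Nat.lt_le_trans with (Nat.log2 (2 * candidate s e i)).
    - rewrite Nat.log2_double; lia.
    - apply Nat.log2_le_mono; lia. }
  induction 1 as [|j _ IH]; [apply G|]; now apply Nat.lt_trans with (1 := IH).
Qed.

Lemma good_exists s : exists D, good s D = true.
Proof.
  destruct (distinct_selection (candidate s)) with (n := S s) as [L [_ [HL [Hinj Hsel]]]].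
  - intros e i j E; destruct (Nat.lt_trichotomy i j) as [H|[H|H]]; auto;
      apply (log2_candidate_lt s e) in H; lia.
  - destruct (odd_meet_solvable L) as [D HD]; auto.
    + intros v Hv; apply HL in Hv; destruct Hv as [e [j ->]]; apply candidate_nonzero.
    + exists D; apply ball_iff; intros e He; apply bex_iff.
      destruct (Hsel e He) as [j [Hj HjL]]; exists j; split; [lia | auto].
Qed.

(** A witness is extracted from a mere existence proof by searching a decidable predicate. Leastness
    identifies it with the result of [RMu]. *)
Lemma good_least s : {D | good s D = true /\ forall i, i < D -> good s i = false}.
Proof.
  destruct (epsilon_smallest (fun D => good s D = true)) as [D [H1 H2]].
  - intros D; apply bool_dec.
  - apply good_exists.
  - exists D; split; auto; intros i Hi; destruct (good s i) eqn:E; auto.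
    apply H2 in E; lia.
Qed.

Definition mask (s : nat) : nat := proj1_sig (good_least s).

Definition coloring (Z : nat) : bool := odd_meet Z (mask (Nat.log2 Z)).

Lemma comp_odd_meet k a b :
  comp k a -> comp k b -> comp k (fun xs => b2n (odd_meet (a xs) (b xs))).
Proof.
  apply (comp_app2 (fun v D => b2n (odd_meet v D))); unfold odd_meet.
  apply comp_ext with (fun xs => nat_rect (fun _ => nat) 0
    (fun i r => b2n (xorb (1 <=? r) (Nat.testbit (hd 0 xs) i && Nat.testbit (hd 0 (tl xs)) i)))
    (hd 0 xs)).
  - intros xs; generalize (hd 0 xs) at 2 3; intros n; induction n as [|n IH]; [reflexivity|].
    cbn [nat_rect parity_below]; rewrite IH; now destruct (parity_below _ _ _).
  - apply (comp_prec 2 (fun _ => 0) (fun i r xs =>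
      b2n (xorb (1 <=? r) (Nat.testbit (hd 0 xs) i && Nat.testbit (hd 0 (tl xs)) i))));
      comp_auto.
Qed.

Lemma comp_candidate k a b c :
  comp k a -> comp k b -> comp k c -> comp k (fun xs => candidate (a xs) (b xs) (c xs)).
Proof.
  apply (comp_app3 candidate).
  apply comp_ext with (fun xs => nat_rect (fun _ => nat) 0
    (fun _ r => next (hd 0 xs) (hd 0 (tl xs)) r) (S (hd 0 (tl (tl xs))))).
  - intros xs; unfold candidate; induction (S (hd 0 (tl (tl xs)))) as [|n IH]; simpl; congruence.
  - apply (comp_prec 3 (fun _ => 0) (fun _ r xs => next (hd 0 xs) (hd 0 (tl xs)) r));
      unfold next, alive; comp_auto.
    apply comp_refutes; comp_auto.
Qed.

Lemma computable_coloring_coloring : computable_coloring coloring.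
Proof.
  assert (H : comp 1 (fun xs => b2n (coloring (hd 0 xs)))).
  { unfold coloring; apply comp_odd_meet; comp_auto.
    apply (comp_app1 mask); [|apply comp_log2; comp_auto].
    (* [mask] is an unbounded search, which terminates at every stage. *)
    apply (comp_mu 1 (fun D xs => good (hd 0 xs) D)).
    - unfold good; comp_auto; apply comp_odd_meet; comp_auto; apply comp_candidate; comp_auto.
    - intros xs; exact (proj2_sig (good_least (hd 0 xs))). }
  destruct H as [e He]; exists e; intros Z; exact (He [Z] eq_refl).
Qed.

(** * Convergence of the guesses *)

Definition true_pair (e p : nat) : Prop := forall s, alive s e p = true.

Lemma alive_anti s t e p : s <= t -> alive t e p = true -> alive s e p = true.
Proof.
  unfold alive; rewrite !negb_true_iff; intros Hst H.
  destruct (bex (S s) _) eqn:E; auto; apply bex_iff in E; destruct E as [T [HT E]].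
  rewrite <- H; symmetry; apply bex_iff; exists T; split; [lia | auto].
Qed.

(** The limit is given by the least true pair above the bound: each smaller pair is either below the
    bound or eventually refuted, and a refuted pair stays so. *)
Lemma next_converges e z :
  (exists p, true_pair e p /\ S (2 * z) <= psnd p) ->
  exists p s0, true_pair e p /\ forall s, s0 <= s -> next s e z = psnd p.
Proof.
  intros H.
  destruct (dec_inh_nat_subset_has_unique_least_element
    (fun p => true_pair e p /\ S (2 * z) <= psnd p)) as [p [[[H1 H2] H3] _]]; auto.
  { intros p; apply classic. }
  set (q s p := (S (2 * z) <=? psnd p) && alive s e p).
  assert (G : forall n, n <= p -> exists s0, forall s i, s0 <= s -> i < n -> q s i = false).
  { induction n as [|n IH]; intros Hn; [exists 0; intros; lia|].
    destruct IH as [s0 Hs0]; [lia|].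
    assert (E : exists t, q t n = false).
    { apply NNPP; intros N; assert (A : forall t, q t n = true).
      { intros t; destruct (q t n) eqn:E; auto; destruct N; eauto. }
      assert (p <= n); [apply H3; split|lia].
      - intros t; specialize (A t); now apply andb_prop in A.
      - specialize (A 0); apply andb_prop in A; now apply Nat.leb_le. }
    destruct E as [t Ht]; exists (Nat.max s0 t); intros s i Hs Hi.
    destruct (Nat.eq_dec i n) as [->|]; [|apply Hs0; lia].
    destruct (q s n) eqn:E; auto; rewrite <- Ht; unfold q in *.
    apply andb_prop in E; destruct E as [E1 E2]; rewrite E1.
    symmetry; apply alive_anti with s; [lia | auto]. }
  destruct (G p) as [s0 Hs0]; auto.
  (* The search at stage [s] stops at [s], so [p] is reached only from stage [p] on. *)
  exists p, (Nat.max s0 p); split; auto; intros s Hs; unfold next.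
  fold (q s); rewrite (bmin_eq _ _ p); [lia|lia| |].
  - intros i Hi; apply Hs0; lia.
  - intros _; apply andb_true_intro; split; [now apply Nat.leb_le | apply H1].
Qed.

Lemma candidate_converges e :
  (forall n, exists p, true_pair e p /\ n <= psnd p) ->
  forall j, exists p s0, true_pair e p /\ forall s, s0 <= s -> candidate s e j = psnd p.
Proof.
  intros H; unfold candidate; induction j as [|j [p [s0 [_ IH]]]].
  - apply (next_converges e 0); auto.
  - destruct (next_converges e (psnd p)) as [p' [t [H1 H2]]]; auto.
    exists p', (Nat.max s0 t); split; auto; intros s Hs.
    rewrite Nat.iter_succ, IH by lia; apply H2; lia.
Qed.

Lemma candidates_converge e :
  (forall n, exists p, true_pair e p /\ n <= psnd p) ->
  forall n, exists s0, forall s, s0 <= s -> forall j, j < n ->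
    candidate s e j < s0 /\ exists p, true_pair e p /\ candidate s e j = psnd p.
Proof.
  intros H; induction n as [|n [s0 IH]]; [exists 0; intros; lia|].
  destruct (candidate_converges e H n) as [p [t [Hp Ht]]].
  (* The sum covers the stage for the earlier guesses, the stage at which the new guess is stable,
     and a strict bound on its value. *)
  exists (s0 + t + S (psnd p)); intros s Hs j Hj.
  destruct (Nat.eq_dec j n) as [->|].
  - rewrite Ht by lia; split; [lia | eauto].
  - destruct (IH s ltac:(lia) j ltac:(lia)) as [G1 G2]; split; [lia | auto].
Qed.

(** By disjointness each number below [k] lies in at most one [f n], so all large [n] avoid these
    numbers. *)
Lemma disjoint_far (f : nat -> nat) :
  (forall m n, m <> n -> f m <> f n) ->
  (forall m n, m <> n -> fdisjoint (f m) (f n)) ->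
  forall k, exists n, f n <> 0 /\ forall i, i < k -> Nat.testbit (f n) i = false.
Proof.
  intros Hinj Hdis k.
  assert (G : exists N, forall n i, N <= n -> i < k -> Nat.testbit (f n) i = false).
  { induction k as [|k [N IH]]; [exists 0; intros; lia|].
    destruct (classic (exists m, Nat.testbit (f m) k = true)) as [[m Hm]|Hm].
    - exists (N + S m); intros n i Hn Hi.
      destruct (Nat.eq_dec i k) as [->|]; [|apply IH; lia].
      generalize (f_equal (fun u => Nat.testbit u k) (Hdis m n ltac:(lia))).
      now rewrite Nat.land_spec, Hm, Nat.bits_0.
    - exists N; intros n i Hn Hi; destruct (Nat.eq_dec i k) as [->|]; [|apply IH; lia].
      destruct (Nat.testbit (f n) k) eqn:E; auto; destruct Hm; eauto. }
  destruct G as [N HN].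
  (* By injectivity at most one of the sets is empty, so [N] or [S N] serves. *)
  destruct (Nat.eq_dec (f N) 0) as [E|E].
  - exists (S N); split; [|intros; apply HN; lia].
    intros E'; apply (Hinj N (S N)); congruence || lia.
  - exists N; split; auto.
Qed.

Lemma not_constant_on_NU S :
  Sigma02 S -> inf_pairwise_disjoint S -> ~ constant_on coloring (NU S).
Proof.
  intros [R [HR HS]] [f [Hf [Hinj Hdis]]] Hc.
  destruct (refutes_universal R HR) as [e He].
  assert (Htrue : forall p, true_pair e p <-> forall y, R (pfst p) y (psnd p) = true).
  { intros p; split.
    - intros Hp y; destruct (R (pfst p) y (psnd p)) eqn:E; auto.
      destruct (proj2 (He (pfst p) (psnd p))) as [T HT]; [eauto|].
      (* Stage [T] is late enough to test the set [T] itself. *)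
      specialize (Hp T); unfold alive in Hp; apply negb_true_iff in Hp.
      rewrite <- Hp; apply bex_iff; exists T; split; [lia | auto].
    - intros Hp s; unfold alive; apply negb_true_iff.
      destruct (bex _ _) eqn:E; auto; apply bex_iff in E; destruct E as [T [_ HT]].
      destruct (proj1 (He (pfst p) (psnd p))) as [y Hy]; [eauto|].
      rewrite Hp in Hy; discriminate. }
  assert (Hunb : forall n, exists p, true_pair e p /\ n <= psnd p).
  { intros n; destruct (disjoint_far f Hinj Hdis n) as [m [Hm0 Hm]].
    destruct (proj1 (HS (f m)) (Hf m)) as [x Hx].
    exists (pair x (f m)); rewrite Htrue, pfst_pair, psnd_pair; split; auto.
    destruct (Nat.le_gt_cases n (f m)) as [|L]; auto.
    generalize (Nat.bit_log2 (f m) Hm0); rewrite Hm; [discriminate|].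
    apply Nat.le_lt_trans with (f m); auto; apply Nat.log2_le_lin; lia. }
  destruct (candidates_converge e Hunb (Datatypes.S e)) as [s0 Hs0].
  (* The part [s0] puts [B] past the stable guesses and their elements; the part [e] makes [e] one
     of the indices treated at stage [s]. *)
  destruct (disjoint_far f Hinj Hdis (s0 + e)) as [m [Hm0 Hm]].
  set (B := f m) in *; set (s := Nat.log2 B).
  assert (Hs : s0 + e <= s).
  { destruct (Nat.le_gt_cases (s0 + e) s) as [|L]; auto.
    generalize (Nat.bit_log2 B Hm0); now rewrite Hm. }
  generalize (proj1 (proj2_sig (good_least s))); fold (mask s); intros Hgood.
  generalize (proj1 (ball_iff _ _) Hgood e ltac:(lia)); intros He'.
  apply bex_iff in He'; destruct He' as [j [Hj Hodd]].
  destruct (Hs0 s ltac:(lia) j Hj) as [Hsmall [p [Hp Ep]]].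
  set (A := candidate s e j) in *.
  assert (HA : S A) by (rewrite Ep; apply HS; exists (pfst p); now apply Htrue).
  assert (HAs : A < 2 ^ s0).
  { apply Nat.lt_trans with s0; auto; apply Nat.pow_gt_lin_r; lia. }
  assert (HAB : Nat.land A B = 0).
  { apply Nat.bits_inj; intros i; rewrite Nat.land_spec, Nat.bits_0.
    destruct (Nat.lt_ge_cases i s0).
    - rewrite Hm by lia; apply andb_false_r.
    - now rewrite (testbit_above A s0). }
  assert (HAl : Nat.log2 A <= s).
  { transitivity (Nat.log2 (2 ^ s0)); [apply Nat.log2_le_mono; lia|].
    rewrite Nat.log2_pow2; lia. }
  assert (HB : NU S B).
  { split; auto; exists [B]; split; [intros W [<-|[]]; apply Hf|].
    unfold big_union, funion, fempty; simpl; now rewrite Nat.lor_0_r. }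
  assert (HU : NU S (Nat.lor A B)).
  { split.
    - unfold fempty; rewrite Nat.lor_eq_0_iff; intuition.
    - exists [A; B]; split; [intros W [<-|[<-|[]]]; auto; apply Hf|].
      unfold big_union, funion, fempty; simpl; now rewrite Nat.lor_0_r. }
  generalize (Hc _ _ HB HU); unfold coloring.
  (* Both sets have maximum [s], so their colours use the same mask, and adding [A] flips the
     parity. *)
  rewrite Nat.log2_lor, Nat.max_r by auto; fold s.
  rewrite odd_meet_lor, Hodd by auto; now destruct (odd_meet B (mask s)).
Qed.

Lemma IP_set_NU S Z : IP_set S -> NU S Z -> S Z.
Proof.
  intros [Hcl _] [H0 [l [Hl ->]]].
  induction l as [|W l IH]; [now destruct H0|]; simpl.
  (* The induction hypothesis speaks only of non-empty unions; if the tail contributes nothing, the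
     union is [W] itself. *)
  destruct (Nat.eq_dec (big_union l) 0) as [E|E].
  - unfold funion; rewrite E, Nat.lor_0_r; apply Hl; simpl; auto.
  - apply Hcl; [apply Hl; simpl; auto | apply IH; auto; intros; apply Hl; simpl; auto].
Qed.

Theorem theorem3p4 :
  exists c : fin_set -> bool,
    computable_coloring c /\
    (forall S : fin_set -> Prop,
        Sigma02 S -> inf_pairwise_disjoint S -> ~ constant_on c (NU S)) /\
    (forall S : fin_set -> Prop,
        IP_set S -> Sigma02 S -> ~ monochromatic c S).
Proof.
  exists coloring; split; [apply computable_coloring_coloring|]; split.
  - apply not_constant_on_NU.
  - intros S HIP HS [b Hb]; apply (not_constant_on_NU S HS (proj2 HIP)).
    intros Z1 Z2 H1 H2; now rewrite !Hb by now apply IP_set_NU.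
Qed.
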